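(* If there exist infinitely many pairs $(i,j)\in(\mathbb{Z}^+)^2$ such that $c=2^i+3^j$ is prime, then $\limsup_{c\to\infty}s_c=\infty$.
   Context: An abc-triple is a triple $(a,b,c)$ of positive integers with $a+b=c$ and $\gcd(a,b)=\gcd(b,c)=\gcd(a,c)=1$. For an abc-triple, $\omega=\omega(abc)$ is the number of distinct primes $p_1,\dots,p_\omega$ dividing $abc$. For a finite set $S=\{x_1,\dots,x_k\}$ of positive reals, $\mathrm{DGM}(S)=\exp\big(\exp\big(\tfrac1k\sum_{i=1}^k\ln\ln x_i\big)\big)$. The DGM quality is $q_{\mathrm{DGM}}(a,b,c)=\dfrac{\ln c}{\ln(\mathrm{DGM}(\{p^\omega: p\mid abc,\ p\text{ prime}\}))}$, equivalently $q_{\mathrm{DGM}}(a,b,c)=\dfrac{\ln c}{\omega\,\big(\prod_{i=1}^{\omega}\ln p_i\big)^{1/\omega}}$. For an integer $c\ge 2$, $s_c=\max\{q_{\mathrm{DGM}}(a,b,c):(a,b,c)\text{ is an abc-triple}\}$, the maximum being over $a,b$ with $c$ fixed. *)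

(* Defs.v *)
From mathcomp Require Import all_boot all_order all_algebra finmap.
From mathcomp Require Import all_classical all_reals all_analysis.

Set Implicit Arguments.
Unset Strict Implicit.
Unset Printing Implicit Defensive.

Import Order.TTheory GRing.Theory Num.Theory.

Local Open Scope classical_set_scope.
Local Open Scope ring_scope.

Definition abc_triple (a b c : nat) : bool :=
  [&& (0 < a)%N, (0 < b)%N, (0 < c)%N, (a + b == c)%N,
      coprime a b, coprime b c & coprime a c].

Definition omega (n : nat) : nat := size (primes n).

Definition DGM (R : realType) (S : {fset R}) : R :=
  expR (expR ((#|` S|)%:R^-1 * \sum_(x <- S) ln (ln x))).

Definition prime_powers (R : realType) (n : nat) : {fset R} :=
  [fset (p%:R ^+ omega n : R) | p in primes n]%fset.
Arguments prime_powers : clear implicits.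

Definition qDGM (R : realType) (a b c : nat) : R :=
  ln (c%:R : R) / ln (DGM (prime_powers R (a * b * c))).
Arguments qDGM : clear implicits.

Definition qDGM_values (R : realType) (c : nat) : set R :=
  [set q | exists a b : nat, abc_triple a b c /\ q = qDGM R a b c].
Arguments qDGM_values : clear implicits.

(* For c >= 2 the supremum is a maximum, see [s_max]; s_ 0 = s_ 1 = 0 are junk
   values. *)
Definition s_ (R : realType) (c : nat) : R := sup (qDGM_values R c).
Arguments s_ : clear implicits.

Lemma s_max (R : realType) (c : nat) : (2 <= c)%N ->
  qDGM_values R c (s_ R c) /\ ubound (qDGM_values R c) (s_ R c).
Proof.
move=> c2.
pose P (a : 'I_c) := abc_triple a (c - a) c.
have P1 : P (Ordinal c2).
  rewrite /P /abc_triple /= subn_gt0 c2 (ltnW c2) subnKC ?eqxx ?coprime1n ?(ltnW c2) //=.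
  by rewrite subn1 andbT coprimePn ?(ltnW c2).
have [a Pa a_max] := @arg_maxP _ _ _ _ P (fun a => qDGM R a (c - a) c) P1.
have ub : ubound (qDGM_values R c) (qDGM R a (c - a) c).
  move=> _ [x [y [xyP ->]]].
  have /and5P[x0 y0 _ /eqP xyc _] := xyP.
  have xc : (x < c)%N by rewrite -xyc -addn1 leq_add2l.
  have yE : y = (c - x)%N by rewrite -xyc addKn.
  by rewrite yE; apply: (a_max (Ordinal xc)); rewrite /P /= -yE.
have mem : qDGM_values R c (qDGM R a (c - a) c) by exists a, (c - a)%N.
have -> // : s_ R c = qDGM R a (c - a) c.
apply/eqP; rewrite eq_le; apply/andP; split.
  by apply: ge_sup => //; exists (qDGM R a (c - a) c).
by apply: ub_le_sup => //; exists (qDGM R a (c - a) c).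
Qed.

(* Main.v *)
(** For prime [c = 2^i + 3^j] the triple [(2^i, 3^j, c)] has [omega = 3], and
    its quality satisfies [q^3 = (ln c)^2 / (27 ln 2 ln 3)], which is unbounded
    as [c] grows. *)

Require Import Defs.
From mathcomp Require Import all_boot all_order all_algebra finmap.
From mathcomp Require Import all_classical all_reals all_analysis.
From mathcomp Require Import ring lra zify.

Import Order.TTheory GRing.Theory Num.Theory.

Local Open Scope classical_set_scope.
Local Open Scope ring_scope.

(** For prime [c = 2 ^ i + 3 ^ j] the product [abc] has only the primes 2, 3 and [c], two of them
    fixed. So the logarithm of the DGM, [3 * (ln 2 * ln 3 * ln c)^(1/3)], grows only like the cube
    root of [ln c], and the quality grows like [(ln c)^(2/3)] ([qDGM_2exp_3exp_prime_cube]).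
    Infinitely many pairs force [c] to be arbitrarily large ([infinite_pairs_exp_unbounded]), so
    [s_ R c], which dominates this quality, exceeds any bound arbitrarily far out, as
    [limn_esup_eqy] requires. *)

Lemma limn_esup_eqy (R : realType) (u : (\bar R)^nat) :
  (forall (r : R) (n : nat), exists2 k, (n <= k)%N & (r%:E <= u k)%E) ->
  limn_esup u = +oo%E.
Proof.
move=> u_unbounded; apply/eqP; rewrite -leye_eq /limn_esup limf_esupE.
apply: le_ereal_inf_tmp => _ [V [n _ nV] <-].
rewrite leye_eq; apply/eqP/eq_infty => r.
have [k nk rk] := u_unbounded r n.
by apply: le_trans rk _; apply: ereal_sup_ubound; exists k => //; exact: nV.
Qed.

(** [prime_powers] is a set, so its cardinal and sums match those over [primes n] only if distinct
    primes give distinct powers. This needs a nonzero exponent, hence [1 < n]. *)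
Lemma prime_powers_inj (R : realType) (n : nat) : (1 < n)%N ->
  injective (fun p : nat => p%:R ^+ omega n : R).
Proof.
move=> n1 p q /eqP; rewrite -!natrX eqr_nat => /eqP.
apply: (@expIn (omega n)).
by rewrite lt0n size_eq0 primes_eq0 -leqNgt.
Qed.

(** [ln (DGM S)] is the geometric mean of the logarithms of the elements of [S]. Raising it to the
    number of elements avoids roots. *)
Lemma ln_DGM_prime_powers_exp (R : realType) (n : nat) : (1 < n)%N ->
  ln (DGM (prime_powers R n)) ^+ omega n =
  \prod_(p <- primes n) (ln (p%:R : R) *+ omega n).
Proof.
move=> n1; have finj := prime_powers_inj R n n1.
have w0 : (0 < omega n)%N by rewrite lt0n size_eq0 primes_eq0 -leqNgt.
have cardE : #|` prime_powers R n| = omega n.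
  by rewrite /prime_powers card_imfset //= undup_id ?primes_uniq.
(* The outer [expR] cancels against [ln], and the power [omega n] cancels the averaging factor,
   leaving [expR] of a plain sum. *)
rewrite /DGM expRK cardE -expRM_natl mulVKf ?pnatr_eq0 -?lt0n //.
rewrite /prime_powers big_imfset /=; last by move=> p q _ _; exact: finj.
rewrite undup_id ?primes_uniq // expR_sum !big_seq.
apply: eq_bigr => p; rewrite mem_primes => /and3P[/prime_gt1 p1 _ _].
have lnp : ln (p%:R ^+ omega n) = ln (p%:R : R) *+ omega n.
  by rewrite lnXn // ltr0n ltnW.
by rewrite lnp lnK // posrE pmulrn_lgt0 // ln_gt0 // ltr1n.
Qed.

Lemma primes_2expM3expMprime (i j c : nat) :
  (0 < i)%N -> (0 < j)%N -> prime c -> (3 < c)%N ->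
  primes (2 ^ i * 3 ^ j * c) = [:: 2; 3; c].
Proof.
move=> i0 j0 pc c3; have c0 := prime_gt0 pc.
(* Strictly sorted lists with the same members are equal; [3 < c] makes [[:: 2; 3; c]] sorted. *)
apply: (irr_sorted_eq ltn_trans ltnn); first exact: sorted_primes.
  by rewrite /= c3.
move=> p; rewrite !primesM ?muln_gt0 ?expn_gt0 // !primesX // !inE.
by rewrite !primes_prime // !inE orbA.
Qed.

Lemma abc_triple_2exp_3exp (i j : nat) : (0 < i)%N -> (0 < j)%N ->
  abc_triple (2 ^ i) (3 ^ j) (2 ^ i + 3 ^ j).
Proof.
move=> i0 j0.
rewrite /abc_triple addn_gt0 !expn_gt0 /= eqxx coprimeXl ?coprimeXr //=.
by rewrite /coprime gcdnDr gcdnDl -!/(coprime _ _) !coprimeXl ?coprimeXr.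
Qed.

(** Cubing removes the cube root: the denominator becomes [(3 ln 2)(3 ln 3)(3 ln c)], and one factor
    [ln c] cancels. *)
Lemma qDGM_2exp_3exp_prime_cube (R : realType) (i j : nat) :
  (0 < i)%N -> (0 < j)%N -> prime (2 ^ i + 3 ^ j) ->
  qDGM R (2 ^ i) (3 ^ j) (2 ^ i + 3 ^ j) ^+ 3 =
  ln ((2 ^ i + 3 ^ j)%:R : R) ^+ 2 / (27 * (ln (2 : R) * ln (3 : R))).
Proof.
move=> i0 j0 pc.
have c3 : (3 < 2 ^ i + 3 ^ j)%N.
  have : (3 ^ 1 <= 3 ^ j)%N by rewrite leq_exp2l.
  have : (0 < 2 ^ i)%N by rewrite expn_gt0.
  lia.
set c := (2 ^ i + 3 ^ j)%N in pc c3 *.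
have prs := primes_2expM3expMprime i j c i0 j0 pc c3.
have w3 : omega (2 ^ i * 3 ^ j * c) = 3%N by rewrite /omega prs.
have n1 : (1 < 2 ^ i * 3 ^ j * c)%N.
  by rewrite ltnNge -ltnS -primes_eq0 prs.
have := ln_DGM_prime_powers_exp R _ n1.
rewrite w3 prs !big_cons big_nil mulr1 /qDGM expr_div_n => ->.
have lnc : ln (c%:R : R) != 0 by rewrite gt_eqF // ln_gt0 // ltr1n ltnW // ltnW.
have ln2 : ln (2 : R) != 0 by rewrite gt_eqF // ln_gt0 // ltr1n.
have ln3 : ln (3 : R) != 0 by rewrite gt_eqF // ln_gt0 // ltr1n.
by field; rewrite lnc ln2 ln3.
Qed.

Lemma infinite_pairs_exp_unbounded (A : set (nat * nat)) (N : nat) :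
  infinite_set A -> exists2 ij, A ij & (N < 2 ^ ij.1 + 3 ^ ij.2)%N.
Proof.
move=> infA; apply: contrapT => noij; apply: infA.
(* If [2 ^ i + 3 ^ j <= N] on all of [A], then [i < 2 ^ i] and [j < 3 ^ j] confine [A] to a finite
   square. *)
apply: (@sub_finite_set _ _ (`I_N `*` `I_N)); last exact: finite_setX.
move=> ij Aij; have [cN|] := ltnP N (2 ^ ij.1 + 3 ^ ij.2).
  by case: noij; exists ij.
move: (ltn_expl ij.1 (isT : (1 < 2)%N)) (ltn_expl ij.2 (isT : (1 < 3)%N)).
by move=> ? ? ?; split => /=; lia.
Qed.

Theorem theorem3p5 (R : realType) :
  infinite_set [set ij : nat * nat |
    [/\ (0 < ij.1)%N, (0 < ij.2)%N & prime (2 ^ ij.1 + 3 ^ ij.2)%N]] ->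
  limn_esup (fun c : nat => (s_ R c)%:E) = +oo%E.
Proof.
move=> infA; apply: limn_esup_eqy => r n.
pose K : R := 27 * (ln 2 * ln 3).
have K0 : 0 < K by rewrite !mulr_gt0 // ln_gt0 // ltr1n.
(* Since [B >= 1], [ln c > B] gives [(ln c)^2 > B >= r ^+ 3 * K], which is the cubed form of
   [r <= q]. Taking [c] above [expR B] achieves this. *)
pose B : R := 1 + `|r ^+ 3 * K|.
have [[i j] [/= i0 j0 pc]] :=
  infinite_pairs_exp_unbounded _ (maxn n (Num.bound (expR B))) infA.
rewrite gtn_max => /andP[nc Bc].
have abc := abc_triple_2exp_3exp i j i0 j0.
have q3 := qDGM_2exp_3exp_prime_cube R i j i0 j0 pc.
set c := (2 ^ i + 3 ^ j)%N in pc nc Bc abc q3 *.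
exists c; first exact: ltnW.
have [_ s_ub] := s_max R (prime_gt1 pc).
rewrite lee_fin (le_trans _ (s_ub _ (ex_intro _ _ (ex_intro _ _ (conj abc erefl))))) //.
have BL : B < ln (c%:R : R).
  rewrite -ltr_expR lnK ?posrE ?ltr0n ?prime_gt0 //.
  apply: lt_trans (_ : (Num.bound (expR B))%:R < _); last by rewrite ltr_nat.
  by apply: archi_boundP; exact: expR_ge0.
(* The sign of [r] is unknown, but assuming [q < r] with [q >= 0] allows cubing the inequality. *)
rewrite leNgt; apply/negP => qr.
have q0 : 0 <= qDGM R (2 ^ i) (3 ^ j) c.
  by rewrite -(@exprn_odd_ge0 _ 3) // q3 divr_ge0 ?sqr_ge0 // ltW.
have : qDGM R (2 ^ i) (3 ^ j) c ^+ 3 < r ^+ 3 by rewrite ltrXn2r.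
rewrite q3 -/K ltr_pdivrMr //; apply/negP; rewrite -leNgt.
have := ler_norm (r ^+ 3 * K); have := normr_ge0 (r ^+ 3 * K).
move: BL; rewrite /B; set x := `|_|; set y := _ * K; set L := ln _.
by nra.
Qed.
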